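(* Let $n\ge 2$, let $w_1\ge\dots\ge w_n\ge 0$ be real weights, let $k\in\{2,\dots,n\}$ and $c_k=w_1-w_k$. Let $\tau\in[0,1)$ and $\gamma\in[0,1-\tau)$, and let $\hat c_k$ be a predicted value of $c_k$. Define (with the convention $0\cdot\ln\frac10=0$) $\alpha_1=1-\gamma-\tau+\tau\ln\frac{1}{1-\gamma}$, $\alpha_2=\frac12\left((1+\gamma)(1-\tau-\gamma)+\tau\ln\frac1\tau+\tau\ln\frac{1}{1-\gamma}\right)$, $\alpha_3=\frac{k+1}{2k}\left(1-\tau-(1-\tau)^{k+1}\right)$, $\alpha_4=\frac32\tau\ln\frac1\tau-\frac12\tau(1-\tau)$. Run the Robust-Consistent algorithm (described in the context) with inputs $\hat c_k,\tau,\gamma$. Then: (i) (consistency) if $\hat c_k=c_k$, then $\mathbb{E}[\mathrm{ALG}]\ge \min\big(\min(\alpha_1,\alpha_2),\max(\alpha_3,\alpha_4)\big)\cdot w_1$; (ii) (robustness) for every value of the prediction $\hat c_k$, $\mathbb{E}[\mathrm{ALG}]\ge \tau\ln\left(\frac{1}{1-\gamma}\right)\cdot w_1$.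
   Context: Secretary setting: $n$ elements with non-negative real weights $w_1\ge\dots\ge w_n$ fixed in advance. Element $i$ has an arrival time $t_i$, where $t_1,\dots,t_n$ are i.i.d. uniform on $[0,1]$; weight $w_i$ is revealed at time $t_i$, and at that moment the algorithm must irrevocably accept or reject it. At most one element may be accepted; $\mathrm{ALG}$ denotes the weight of the accepted element (0 if none); the expectation is over the arrival times. For $\tau\in[0,1]$, $\mathrm{BSF}(\tau)=\max_{i:t_i\le\tau}w_i$ (taken to be $0$ if no element has arrived by time $\tau$). The Robust-Consistent algorithm with inputs a predicted gap $\hat c$, a time $\tau\in[0,1)$ and $\gamma\in[0,1-\tau)$: reject all elements arriving up to time $\tau$; at time $\tau$ compute $\mathrm{BSF}(\tau)$; for elements arriving between time $\tau$ and time $1-\gamma$, accept the first one with $w_i\ge\max(\mathrm{BSF}(\tau),\hat c)$; if nothing has been accepted by time $1-\gamma$, accept the first element arriving after time $1-\gamma$ with $w_i\ge \mathrm{BSF}(\tau)$.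
   Formalization: Equal weights are ordered by index: an element tied with one that arrived by time τ is accepted only if its index is smaller. With the literal test w_i ≥ BSF(τ) the bounds fail, e.g. for weights 1,0,0,0,0, prediction 0, τ=1/e, γ=1/2; for distinct weights nothing changes. *)

(* Defs.v *)
From HB Require Import structures.
From mathcomp Require Import all_boot all_order all_algebra.
From mathcomp Require Import all_classical all_reals all_analysis.

Set Implicit Arguments.
Unset Strict Implicit.
Unset Printing Implicit Defensive.

Import Order.TTheory GRing.Theory Num.Theory.

Local Open Scope ring_scope.

(* Elements are indexed by 'I_n, i.e., from 0: the weight written w_i on paper
   is the value of w at the ordinal i - 1. *)

Section Algorithm.
Context {R : realType} {n : nat}.
Implicit Types (w t : 'I_n -> R) (tau gamma chat thr : R).

(* The default 0 is the value when nothing has arrived by time tau; it does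
   not affect the maximum otherwise, as weights are non-negative. *)
Definition bsf w t tau : R := \big[Num.max/0]_(i < n | t i <= tau) w i.

(* Weights may be equal, and the test  w_i >= BSF(tau)  then has to be read
   with a fixed tie-breaking order: among equal weights, the smaller index
   counts as the larger one.  Accepting every element that merely equals
   BSF(tau) is not intended: with weights 1, 0, ..., 0 and chat = 0 it would
   accept the first element to arrive after tau, and neither the consistency
   nor the robustness bound would hold.  The clause is void for distinct
   weights (meets_inj). *)
Definition wins_ties w t tau (i : 'I_n) : bool :=
  [forall j, (t j <= tau) && (w j == w i) ==> (i < j)%N].

Definition meets w t tau thr (i : 'I_n) : bool :=
  (thr <= w i) && wins_ties w t tau i.

Lemma meets_inj w t tau thr i :
  injective w -> tau < t i -> meets w t tau thr i = (thr <= w i).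
Proof.
move=> w_inj ti; rewrite /meets andb_idr// => _.
apply/forallP => j; apply/implyP => /andP[tj /eqP/w_inj ji].
by rewrite ji leNgt ti in tj.
Qed.

(* Simultaneous arrivals form a null event; [pick] settles them arbitrarily. *)
Definition first_arrival t (A : pred 'I_n) : option 'I_n :=
  [pick i | A i && [forall j, A j ==> (t i <= t j)]].

Definition early_candidate w t chat tau gamma : pred 'I_n :=
  fun i => (tau < t i <= 1 - gamma) &&
           meets w t tau (Num.max (bsf w t tau) chat) i.

Definition late_candidate w t tau gamma : pred 'I_n :=
  fun i => (1 - gamma < t i) && meets w t tau (bsf w t tau) i.

Definition accepted w t chat tau gamma : option 'I_n :=
  if first_arrival t (early_candidate w t chat tau gamma) is Some i
  then Some i
  else first_arrival t (late_candidate w t tau gamma).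

Definition alg w t chat tau gamma : R :=
  if accepted w t chat tau gamma is Some i then w i else 0.

End Algorithm.

Section ArrivalTimes.
Local Open Scope classical_set_scope.
Local Open Scope ereal_scope.
Context {d : measure_display} {T : measurableType d} {R : realType}.
Context {P : probability T R} {n : nat}.

Definition mutually_independent (X : 'I_n -> {RV P >-> R}) : Prop :=
  forall (J : {set 'I_n}) (A : 'I_n -> set R), (forall i, measurable (A i)) ->
    P (\bigcap_(i in [set` J]) (X i @^-1` A i)) =
    \prod_(i in J) P (X i @^-1` A i).

Definition uniform01 (X : {RV P >-> R}) : Prop :=
  forall A : set R, measurable A ->
    distribution P X A = uniform_prob (@ltr01 R) A.

End ArrivalTimes.

Section Bounds.
Context {R : realType}.
Implicit Types (tau gamma : R) (k : nat).

(* At tau = 0 the terms tau * ln (1 / tau) are 0. *)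

Definition alpha1 tau gamma : R :=
  1 - gamma - tau + tau * ln (1 / (1 - gamma)).

Definition alpha2 tau gamma : R :=
  1 / 2 * ((1 + gamma) * (1 - tau - gamma) + tau * ln (1 / tau)
           + tau * ln (1 / (1 - gamma))).

Definition alpha3 k tau : R :=
  k.+1%:R / (2 * k%:R) * (1 - tau - (1 - tau) ^+ k.+1).

Definition alpha4 tau : R :=
  3 / 2 * tau * ln (1 / tau) - 1 / 2 * tau * (1 - tau).

End Bounds.

(* Main.v *)
Require Import Defs.
From HB Require Import structures.
From mathcomp Require Import all_boot all_order all_algebra.
From mathcomp Require Import all_classical all_reals all_analysis.
From mathcomp Require Import measurable_realfun.
From mathcomp Require Import ring lra.

Set Implicit Arguments.
Unset Strict Implicit.
Unset Printing Implicit Defensive.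

Import Order.TTheory GRing.Theory Num.Theory.

Local Open Scope ring_scope.

(* With ties broken by index, element i qualifies exactly when no element of
   index at most i arrived by time tau. If element p arrives at time x > tau,
   every better element arrives after x, and the best of the worse elements
   arriving before x (if any) arrived before tau, then p is accepted as soon as
   chat <= w p or x > 1 - gamma. Given t_p = x this has probability at least
   (1 - x)^p * tau / x (ranks from 0); integrating over x gives tau ln (1 / tau)
   for the best element, tau ln (1 / (1 - gamma)) for its late part, and
   tau ln (1 / tau) - tau (1 - tau) for the second best.

   The late part alone gives robustness. For consistency, put c = w_1 - w_k.
   If w_2 < c, only the best element can be accepted early: alpha1.
   If w_1 / 2 <= c <= w_2, every element accepted early is worth w_1 / 2, and
   there is one whenever the best element, or the second best followed by a late
   best, arrives in (tau, 1 - gamma]: alpha2.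
   If c < w_1 / 2, the elements 1, ..., k are worth at least w_1 / 2. Something
   of rank at most k is accepted when the best element arrives after tau and one
   of the ranks 2, ..., k + 1 before it: alpha3. Counting the two best elements
   only gives alpha4. *)

(** * The algorithm for fixed arrival times *)

Section Selection.
Context {R : realType} {n : nat}.
Variables (w : 'I_n -> R) (t : 'I_n -> R) (chat tau gamma : R).
Hypothesis w_ge0 : forall i, 0 <= w i.
Hypothesis w_noninc : forall i j : 'I_n, (i <= j)%N -> w j <= w i.

(** Free of weights, hence of ties; the instance [j = i] forces [i] to arrive after [tau]. *)
Definition beats_sample (i : 'I_n) : bool :=
  [forall j, (t j <= tau) ==> (i < j)%N].

(** A sampled [j <= i] would weigh at least [w i], hence exactly [w i] by the threshold, and the tie
    rule then excludes it. *)
Lemma meets_beats_sample i : Defs.meets w t tau (bsf w t tau) i = beats_sample i.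
Proof.
apply/andP/forallP => [[/bigmax_leP[_ bsf_le] /forallP ties] j|beats].
  apply/implyP => tj; rewrite ltnNge; apply/negP => ji.
  have wij : w j = w i by apply/eqP; rewrite eq_le bsf_le// w_noninc.
  by have /implyP := ties j; rewrite tj wij eqxx ltnNge ji => /(_ isT).
split.
  apply/bigmax_leP; split=> // j tj.
  by apply/w_noninc/ltnW; exact: (implyP (beats j)).
apply/forallP => j; apply/implyP => /andP[tj _].
exact: (implyP (beats j)).
Qed.

Lemma early_candidateE i : early_candidate w t chat tau gamma i =
  [&& tau < t i, t i <= 1 - gamma, chat <= w i & beats_sample i].
Proof.
rewrite /early_candidate -meets_beats_sample /Defs.meets ge_max -!andbA.
by do 2!congr andb; rewrite andbCA.
Qed.

Lemma late_candidateE i : late_candidate w t tau gamma i =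
  (1 - gamma < t i) && beats_sample i.
Proof. by rewrite /late_candidate meets_beats_sample. Qed.

Lemma first_arrival_mem (A : pred 'I_n) i : first_arrival t A = Some i -> A i.
Proof. by rewrite /first_arrival; case: pickP => // j /andP[Aj _] [<-]. Qed.

Lemma first_arrival_ex (A : pred 'I_n) i : A i ->
  exists j, first_arrival t A = Some j.
Proof.
move=> Ai; rewrite /first_arrival; case: pickP => [j _|]; first by exists j.
case: (arg_minP t Ai) => j Aj minj /(_ j); rewrite Aj /= => /negP[].
by apply/forallP => l; apply/implyP/minj.
Qed.

Lemma first_arrival_uniq (A : pred 'I_n) i : A i ->
  (forall j, A j -> t j <= t i -> j = i) -> first_arrival t A = Some i.
Proof.
move=> Ai uniqi; have [j] := first_arrival_ex Ai.
rewrite /first_arrival; case: pickP => // l /andP[Al /forallP minl] _.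
by congr Some; apply: uniqi => //; exact: (implyP (minl i)).
Qed.

Lemma first_arrival_none (A : pred 'I_n) :
  (forall j, ~~ A j) -> first_arrival t A = None.
Proof.
by move=> Afalse; rewrite /first_arrival; case: pickP => // j;
  rewrite (negbTE (Afalse j)).
Qed.

Lemma alg_ge0 : 0 <= alg w t chat tau gamma.
Proof. by rewrite /alg; case: accepted. Qed.

Lemma early_alg_ge i : early_candidate w t chat tau gamma i ->
  chat <= alg w t chat tau gamma.
Proof.
move=> /first_arrival_ex[j jacc]; rewrite /alg /accepted jacc.
by move/first_arrival_mem: jacc; rewrite early_candidateE => /and4P[].
Qed.

(** Which element is accepted stays unknown, but its rank is controlled by the sample. Depending on
    its arrival time, [i] is an early or a late candidate, so some phase accepts. *)
Lemma alg_beats_sample i : tau < t i -> chat <= w i -> beats_sample i ->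
  exists2 j, alg w t chat tau gamma = w j & beats_sample j.
Proof.
move=> taui wi bi; rewrite /alg /accepted.
case Eearly: first_arrival => [j|].
  exists j => //; move/first_arrival_mem: Eearly.
  by rewrite early_candidateE => /and4P[].
have [ti|ti] := leP (t i) (1 - gamma).
  have [] := @first_arrival_ex (early_candidate w t chat tau gamma) i.
    by rewrite early_candidateE taui ti wi.
  by move=> j; rewrite Eearly.
have [] := @first_arrival_ex (late_candidate w t tau gamma) i.
  by rewrite late_candidateE ti.
move=> j jacc; exists j; first by rewrite jacc.
by move/first_arrival_mem: jacc; rewrite late_candidateE => /andP[].
Qed.

Lemma alg_only_early i : tau < t i <= 1 - gamma -> chat <= w i ->
  beats_sample i -> (forall j, chat <= w j -> j = i) ->
  alg w t chat tau gamma = w i.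
Proof.
move=> /andP[taui ti] wi bi onlyi; rewrite /alg /accepted.
rewrite (@first_arrival_uniq _ i)//; first by rewrite early_candidateE taui ti wi.
by move=> j; rewrite early_candidateE => /and4P[_ _ wj _] _; exact: onlyi.
Qed.

(** The second clause avoids naming the best worse element: each worse one arriving in between is
    dominated by a sampled one. If [tau < t p], the first clause forces the dominating index above
    [p]. *)
Definition first_record (p : 'I_n) : Prop :=
  (forall j : 'I_n, (j < p)%N -> t p < t j) /\
  (forall j : 'I_n, (p < j)%N -> tau < t j <= t p ->
     exists2 i : 'I_n, (i < j)%N & t i <= tau).

Lemma first_record_alg p : 0 <= gamma -> tau < 1 - gamma -> tau < t p ->
  (t p <= 1 - gamma -> chat <= w p) -> first_record p ->
  alg w t chat tau gamma = w p.
Proof.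
move=> g0 tau_lt taup wp [better worse].
have bp : beats_sample p.
  apply/forallP => j; apply/implyP => tj; rewrite ltnNge leq_eqVlt negb_or.
  apply/andP; split.
    by apply/eqP => /ord_inj jp; move: taup; rewrite -jp ltNge tj.
  by apply/negP => /better; rewrite ltNge (le_trans tj)// ltW.
(* Up to time [t p], no element but [p] qualifies: better ones come later, worse ones are dominated
   by the sample. *)
have only j : tau < t j -> beats_sample j -> t j <= t p -> j = p.
  move=> tauj /forallP bj tjp; case: (ltngtP j p) => [|pj|/ord_inj//].
    by move/better; rewrite ltNge tjp.
  have [|i ij ti] := worse j pj; first by rewrite tauj.
  by have := implyP (bj i) ti; rewrite ltnNge ltnW.
rewrite /alg /accepted; have [tp|tp] := leP (t p) (1 - gamma).
  rewrite (@first_arrival_uniq _ p)//.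
    by rewrite early_candidateE taup tp wp.
  by move=> j; rewrite early_candidateE => /and4P[? _ _ ?]; exact: only.
(* When [p] arrives late, an early candidate would precede it and so be [p] itself. *)
rewrite (@first_arrival_none (early_candidate _ _ _ _ _)).
  rewrite (@first_arrival_uniq _ p)//; first by rewrite late_candidateE tp.
  move=> j; rewrite late_candidateE => /andP[tj bj].
  by apply: only => //; exact: lt_trans tj.
move=> j; rewrite early_candidateE; apply/and4P => -[tauj tj _ bj].
have jp := only j tauj bj (le_trans tj (ltW tp)).
by move: tj; rewrite jp leNgt tp.
Qed.

End Selection.

(** * Real-valued probabilities and lower bounds on expectations *)

Section Expectation.
Local Open Scope classical_set_scope.
Local Open Scope ring_scope.
Context d (T : measurableType d) (R : realType) (P : probability T R).

Definition pr (A : set T) : R := fine (P A).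

Lemma prE A : measurable A -> P A = (pr A)%:E.
Proof. by move=> mA; rewrite fineK// fin_num_measure. Qed.

Lemma pr_ge0 A : 0 <= pr A.
Proof. exact: fine_ge0. Qed.

Lemma prT : pr setT = 1.
Proof. by rewrite /pr probability_setT. Qed.

Lemma prU A B : measurable A -> measurable B -> A `&` B = set0 ->
  pr (A `|` B) = pr A + pr B.
Proof.
move=> mA mB AB; apply: EFin_inj.
by rewrite EFinD -!prE ?measureU//; exact: measurableU.
Qed.

Lemma prDI A B : measurable A -> measurable B ->
  pr A = pr (A `\` B) + pr (A `&` B).
Proof.
move=> mA mB; rewrite -prU//.
- by rewrite -setDDr setDv setD0.
- exact: measurableD.
- exact: measurableI.
- by rewrite setDE setIACA setICl setI0.
Qed.

Lemma le_pr A B : measurable A -> measurable B -> A `<=` B -> pr A <= pr B.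
Proof.
by move=> mA mB AB; rewrite -lee_fin -!prE// le_measure// inE.
Qed.

(* Monotonicity of the integral holds without measurability of the larger
   function, because the integral of a non-negative function is a supremum
   over the simple functions below it. *)
Lemma le_expectation_indic (s : seq (set T)) (c : R) (f : T -> R) :
  {in s, forall A, measurable A} -> 0 <= c ->
  (forall x, c * \sum_(A <- s) \1_A x <= f x) ->
  ((c * \sum_(A <- s) pr A)%:E <= 'E_P[f])%E.
Proof.
move=> ms c0 le_f.
have g0 x : 0 <= c * \sum_(A <- s) \1_A x :> R.
  by rewrite mulr_ge0// sumr_ge0.
have mnth i : measurable (nth set0 s i).
  have [/ms//|si] := boolP (nth set0 s i \in s).
  by rewrite nth_default// leqNgt; apply: contra si => /mem_nth.
have -> : (c * \sum_(A <- s) pr A)%:E =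
    (\int[P]_x (c * \sum_(A <- s) \1_A x)%:E)%E.
  under eq_integral do rewrite EFinM (big_nth set0) -sumEFin.
  rewrite ge0_integralZl_EFin//; last 2 first.
  - by move=> x _; rewrite sume_ge0// => i _; rewrite lee_fin.
  - apply: emeasurable_sum => i.
    exact/measurable_EFinP/measurable_indic.
  rewrite ge0_integral_sum//; last first.
    by move=> i; exact/measurable_EFinP/measurable_indic.
  rewrite EFinM -sumEFin (big_nth set0); congr (_ * _)%E.
  apply: eq_bigr => i _; rewrite integral_indic// setIT; exact/esym/prE.
rewrite expectation.unlock !ge0_integralTE; last 2 first.
- by move=> x; rewrite lee_fin (le_trans (g0 x)).
- by move=> x; rewrite lee_fin.
apply: le_ereal_sup => _ [h hg <-]; exists h => // x.
by rewrite (le_trans (hg x))// lee_fin.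
Qed.

End Expectation.

(* Riemann sums over a geometric partition of [lo, hi] replace the integral of
   s / x, so that neither Fubini nor a joint law of the arrival times is
   needed. *)
Lemma ln_le_superadditive (R : realType) (m : R -> R -> R) (s lo hi : R) :
  0 <= s -> 0 < lo -> lo <= hi ->
  (forall a b c, lo <= a -> a <= b -> b <= c -> c <= hi ->
     m a b + m b c <= m a c) ->
  (forall a b, lo <= a -> a <= b -> b <= hi -> s * (b - a) / b <= m a b) ->
  s * ln (hi / lo) <= m lo hi.
Proof.
move=> s0 lo0 lohi madd mstep.
have hi0 : 0 < hi by exact: lt_le_trans lohi.
set L := ln (hi / lo).
have L0 : 0 <= L by rewrite ln_ge0// ler_pdivlMr// mul1r.
have hiE : hi = lo * expR L.
  by rewrite lnK ?posrE ?divr_gt0// mulrC divfK// gt_eqF.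
(* A cell of ratio [expR u] contributes at least [s * (1 - (expR u)^-1)]; this rational lower bound
   makes the limit over partitions elementary. *)
have rat_ln (u : R) : 0 <= u -> u / (1 + u) <= 1 - (expR u)^-1.
  move=> u0; have u1 : 0 < 1 + u by rewrite ltr_pwDl.
  have -> : u / (1 + u) = 1 - (1 + u)^-1.
    by field; rewrite gt_eqF.
  by rewrite lerD2l lerN2 lef_pV2 ?posrE ?expR_gt0// expR_ge1Dx.
have bound N : (0 < N)%N -> s * (L / (1 + L / N%:R)) <= m lo hi.
  move=> N0; have N0R : 0 < N%:R :> R by rewrite ltr0n.
  set u := L / N%:R; have u0 : 0 <= u by rewrite divr_ge0// ltW.
  set y := fun j : nat => lo * expR u ^+ j.
  have eu1 : 1 <= expR u by rewrite -expR0 ler_expR.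
  have y0 j : 0 < y j by rewrite mulr_gt0// exprn_gt0// expR_gt0.
  have y_le i j : (i <= j)%N -> y i <= y j.
    by move=> ij; rewrite ler_pM2l// ler_weXn2l.
  have yN : y N = hi by rewrite /y -expRM_natl [_ * u]mulrC divfK ?gt_eqF.
  have : forall j, (j <= N)%N -> s * (j%:R * (u / (1 + u))) <= m lo (y j).
    elim=> [_|j IH jN].
      (* The degenerate cell gives [0 <= m lo lo]. *)
      have := mstep lo lo; rewrite /y expr0 mulr1 subrr mulr0 !mul0r mulr0.
      by apply.
    have := madd lo (y j) (y j.+1) (lexx _).
    rewrite -{1}[lo]mulr1 -(expr0 (expR u)) -yN => madd_j.
    apply: (le_trans _ (madd_j _ _ _)); rewrite ?y_le//; try exact: ltnW.
    rewrite -addn1 natrD mulrDl mul1r mulrDr lerD ?IH ?(ltnW jN)//.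
    rewrite addn1; apply: (le_trans _ (mstep _ _ _ _ _)).
    - rewrite -mulrA ler_wpM2l// (le_trans (rat_ln u u0))//.
      rewrite mulrBl divff ?gt_eqF// lerD2l lerN2 /y exprSr.
      by rewrite mulrA invfM mulrA divff ?mul1r// gt_eqF// y0.
    - by rewrite -[leLHS]mulr1 -(expr0 (expR u)) y_le.
    - exact: y_le.
    - by rewrite -yN y_le.
  move=> /(_ N (leqnn _)); rewrite yN; apply: le_trans.
  by rewrite ler_wpM2l// /u mulrA mulrCA divff ?gt_eqF// mulr1.
apply/ler_addgt0Pr => e e0.
(* The bound for N cells falls short of s L by at most s L^2 / N, which is below e for this N. *)
pose N := (Num.truncn (s * L * L / e)).+1.
have sLN : s * L * L / e < N%:R by rewrite /N truncnS_gt.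
have N0 : 0 < N%:R :> R by rewrite ltr0n.
have := bound N isT; rewrite -lerBlDr; apply: le_trans.
have u1 : 0 < 1 + L / N%:R by rewrite ltr_pwDl// divr_ge0// ltW.
have sLN_le : s * L * (L / N%:R) <= e.
  by rewrite mulrA ler_pdivrMr// [leRHS]mulrC -ler_pdivrMr// ltW.
have eL0 : 0 <= e * (L / N%:R) by rewrite mulr_ge0 ?divr_ge0// ltW.
by rewrite [s * (L / _)]mulrA ler_pdivlMr//; lra.
Qed.

(** * Product events for independent uniform arrival times *)

Section Arrivals.
Local Open Scope classical_set_scope.
Local Open Scope ring_scope.
Context d (T : measurableType d) (R : realType) (P : probability T R) (n : nat).
Variable t : 'I_n -> {RV P >-> R}.
Hypothesis t_indep : mutually_independent t.
Hypothesis t_unif : forall i, uniform01 (t i).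
Implicit Types (A : 'I_n -> set R) (i j p : 'I_n) (B : set R).

Lemma measurable_arrival i B : measurable B -> measurable (t i @^-1` B).
Proof. by move=> mB; exact: measurable_funPTI. Qed.

Lemma pr_arrivalE i B : measurable B ->
  P (t i @^-1` B) = lebesgue_measure (B `&` `[0, 1]).
Proof.
move=> mB; have := t_unif i mB; rewrite /distribution/= /pushforward => ->.
rewrite /uniform_prob integral_uniform_pdf.
rewrite (eq_integral (fun=> 1%:E)); last first.
  by move=> x; rewrite inE/= => -[_]; rewrite in_itv/= /uniform_pdf subr0 invr1 => ->.
by rewrite integral_cst ?mul1e//; exact: measurableI.
Qed.

Lemma pr_arrival_oc i (a b : R) : 0 <= a -> a <= b -> b <= 1 ->
  pr P (t i @^-1` `]a, b]) = b - a.
Proof.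
move=> a0 ab b1; rewrite /pr pr_arrivalE//.
rewrite (_ : _ `&` _ = `]a, b]%classic); last first.
  apply/seteqP; split=> [x []//|x /=]; rewrite !in_itv/= => /andP[ax xb].
  by rewrite ax xb (le_trans xb b1) (le_trans a0 (ltW ax)).
rewrite lebesgue_measure_itv/= lte_fin; case: ltP => [//|ba].
have -> : b = a by apply/eqP; rewrite eq_le ab ba.
by rewrite subrr.
Qed.

Lemma pr_arrival_le i (a : R) : 0 <= a <= 1 ->
  pr P (t i @^-1` `]-oo, a]) = a.
Proof.
move=> /andP[a0 a1]; rewrite /pr pr_arrivalE//.
rewrite (_ : _ `&` _ = `[0, a]%classic); last first.
  apply/seteqP; split=> [x []/=|x /=]; rewrite !in_itv/=.
    by move=> xa /andP[-> _].
  by move=> /andP[x0 xa]; rewrite xa x0 (le_trans xa a1).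
rewrite lebesgue_measure_itv/= lte_fin; case: ltP => [_|a0'].
  by rewrite /= subr0.
by apply/esym/eqP; rewrite eq_le a0'.
Qed.

Lemma pr_arrival_gt i (a : R) : 0 <= a <= 1 ->
  pr P (t i @^-1` `]a, +oo[) = 1 - a.
Proof.
move=> a01; rewrite -[in RHS](pr_arrival_le i a01) -(prT P).
have /(prDI P measurableT) -> : measurable (t i @^-1` `]-oo, a]).
  exact: measurable_arrival.
rewrite setTI addrK setTD; congr (pr _ _).
by apply/seteqP; split=> x /=; rewrite !in_itv/= andbT ltNge => /negP.
Qed.

Definition rect A : set T := [set x | forall i, A i (t i x)].

Lemma rectE A : rect A = \bigcap_(i in [set: 'I_n]) (t i @^-1` A i).
Proof. by apply/seteqP; split=> x Ax i => [_|]; exact: Ax. Qed.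

Lemma measurable_rect A : (forall i, measurable (A i)) -> measurable (rect A).
Proof.
move=> mA; rewrite rectE; apply: fin_bigcap_measurable => // i _.
exact: measurable_arrival.
Qed.

Lemma pr_rect A : (forall i, measurable (A i)) ->
  pr P (rect A) = \prod_i pr P (t i @^-1` A i).
Proof.
move=> mA; have := t_indep [set: 'I_n]%SET mA.
rewrite (_ : \bigcap_(i in _) _ = rect A); last first.
  apply/seteqP; split=> x Ax i => [|_]; last exact: Ax.
  by apply: Ax; rewrite /= inE.
rewrite /pr => ->; rewrite (eq_bigr (fun i => (pr P (t i @^-1` A i))%:E)).
  by rewrite -(big_morph EFin EFinM erefl)/=; apply: eq_bigl => i; rewrite inE.
by move=> i _; apply: prE; exact: measurable_arrival.
Qed.

(** Overwrites coordinate [j]; it is applied where [A j = setT], so that it amounts to an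
    intersection and multiplies the probability. *)
Definition constrain A j B : 'I_n -> set R := fun i => if i == j then B else A i.

Lemma rect_constrain A j B : A j = setT ->
  rect A `&` t j @^-1` B = rect (constrain A j B).
Proof.
move=> Aj; apply/seteqP; split=> x.
  by move=> [Ax Bx] i; rewrite /constrain; case: eqP => [->|_].
move=> ABx; split=> [i|]; last by have := ABx j; rewrite /constrain eqxx.
by have := ABx i; rewrite /constrain; case: eqP => [->|//]; rewrite Aj.
Qed.

Lemma measurable_constrain A j B : (forall i, measurable (A i)) ->
  measurable B -> forall i, measurable (constrain A j B i).
Proof. by move=> mA mB i; rewrite /constrain; case: eqP. Qed.

Lemma pr_constrain A j B : (forall i, measurable (A i)) -> measurable B ->
  A j = setT ->
  pr P (rect (constrain A j B)) = pr P (rect A) * pr P (t j @^-1` B).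
Proof.
move=> mA mB Aj; rewrite !pr_rect//; last exact: measurable_constrain.
rewrite (bigD1 j)//= [in RHS](bigD1 j)//= Aj preimage_setT prT mul1r mulrC.
congr (_ * _); last by rewrite /constrain eqxx.
by apply: eq_bigr => i ij; rewrite /constrain (negbTE ij).
Qed.

Lemma pr_arrivalI i j (B C : set R) : i != j -> measurable B -> measurable C ->
  pr P (t i @^-1` B `&` t j @^-1` C) =
  pr P (t i @^-1` B) * pr P (t j @^-1` C).
Proof.
move=> ij mB mC; have mT l : measurable ((fun=> setT) l : set R) by [].
have Bj : constrain (fun=> setT) i B j = setT.
  by rewrite /constrain eq_sym (negbTE ij).
have rectT : rect (fun=> setT) = setT by apply/seteqP; split.
rewrite -[t i @^-1` B]setTI -{1}rectT rect_constrain// rect_constrain//.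
rewrite pr_constrain//; last exact: measurable_constrain.
by rewrite pr_constrain// rectT prT mul1r setTI.
Qed.

Lemma pr_rect_half (Q : pred 'I_n) (a : R) : 0 <= a <= 1 ->
  pr P (rect (fun i => if Q i then `]a, +oo[%classic else setT)) = (1 - a) ^+ #|Q|.
Proof.
move=> a01; rewrite pr_rect; last by move=> i; case: ifP.
rewrite (eq_bigr (fun i => if Q i then 1 - a else 1)); last first.
  by move=> i _; case: ifP => _; rewrite ?pr_arrival_gt// preimage_setT prT.
by rewrite -big_mkcond prodr_const.
Qed.

(* The best element of [s], listed from the best, that has arrived by time
   [x], if any, had already arrived by time [tau]. *)
Fixpoint shielded (tau x : R) (s : seq 'I_n) : set T :=
  if s is j :: s' then
    t j @^-1` `]-oo, tau] `|` (t j @^-1` `]x, +oo[ `&` shielded tau x s')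
  else setT.

Lemma measurable_shielded tau x s : measurable (shielded tau x s).
Proof.
elim: s => //= j s IH; apply: measurableU; first exact: measurable_arrival.
by apply: measurableI => //; exact: measurable_arrival.
Qed.

(** Induction on [s]: its head arrives by [tau], or after [x] and the tail takes over. The ratio tau
    / x is the fixed point of q = tau + (1 - x) q, so the bound does not depend on the length of
    [s]. *)
Lemma pr_rect_shielded A tau x s : (forall i, measurable (A i)) ->
  0 <= tau -> tau <= x -> 0 < x -> x <= 1 ->
  uniq s -> (forall j, j \in s -> A j = setT) ->
  pr P (rect A) * (tau / x) <= pr P (rect A `&` shielded tau x s).
Proof.
move=> + tau0 taux x0 x1.
have tau1 : tau <= 1 by exact: le_trans x1.
elim: s A => [A mA _ _|j s IH A mA /= /andP[js us] AT] /=.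
  by rewrite setIT ler_piMr ?pr_ge0// ler_pdivrMr// mul1r.
have Aj : A j = setT by apply: AT; rewrite mem_head.
rewrite setIUr setIA !rect_constrain// prU; first last.
- rewrite -!rect_constrain//; apply/seteqP; split=> // y /= [[_ yt] [[_ yx] _]].
  move: yt yx; rewrite !in_itv/= => ytau; rewrite andbT ltNge.
  by rewrite (le_trans ytau).
- apply: measurableI; last exact: measurable_shielded.
  by apply: measurable_rect; exact: measurable_constrain.
- by apply: measurable_rect; exact: measurable_constrain.
rewrite pr_constrain// pr_arrival_le ?tau0//.
have mB := measurable_constrain j mA (measurable_itv `]x, +oo[).
have /(IH _ mB us) : forall i, i \in s -> constrain A j `]x, +oo[ i = setT.
  move=> i is_; rewrite /constrain; case: eqP => [ij|_].
    by move: js; rewrite -ij is_.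
  by apply: AT; rewrite inE is_ orbT.
rewrite pr_constrain// pr_arrival_gt ?(ltW x0)//.
rewrite -(lerD2l (pr P (rect A) * tau)); apply: le_trans.
by rewrite le_eqVlt; apply/orP; left; apply/eqP; field; rewrite gt_eqF.
Qed.

(** The first element of [s] arriving by [x] arrived by [tau], so it is not [j]; it precedes [j] in
    the list and has a smaller index. *)
Lemma shielded_blocked tau x s y j : sorted (fun i i' : 'I_n => (i < i')%N) s ->
  shielded tau x s y -> j \in s -> tau < t j y <= x ->
  exists2 i : 'I_n, (i < j)%N & t i y <= tau.
Proof.
move=> + + + /andP[tauj jx]; elim: s => //= i s IH ord_s.
have i_lt : forall i', i' \in s -> (i < i')%N.
  have /= := order_path_min _ ord_s => /(_ _)/allP.
  by apply=> a b c; exact: ltn_trans.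
rewrite in_cons !in_itv/=; case=> [ti|[ti sh]] /orP[/eqP ji|js].
- by move: ti; rewrite -ji leNgt tauj.
- by exists i; first exact: i_lt.
- by move: ti; rewrite andbT -ji ltNge jx.
- by apply: IH => //; exact: path_sorted ord_s.
Qed.

End Arrivals.

Lemma card_ord_lt n k : (k <= n)%N -> #|[pred i : 'I_n | (i < k)%N]| = k.
Proof.
move=> kn; rewrite -sum1_card -(big_ord_widen n (fun=> 1%N) kn).
by rewrite sum1_card card_ord.
Qed.

(** * Probabilities of first records *)

Section Records.
Local Open Scope classical_set_scope.
Local Open Scope ring_scope.
Context d (T : measurableType d) (R : realType) (P : probability T R) (n : nat).
Variable t : 'I_n -> {RV P >-> R}.
Hypothesis t_indep : mutually_independent t.
Hypothesis t_unif : forall i, uniform01 (t i).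
Variable tau : R.
Hypothesis tau_ge0 : 0 <= tau.

Definition record_event (p : 'I_n) (a b : R) : set T :=
  [set x | a < t p x <= b /\ first_record (fun i => t i x) tau p].

Lemma measurable_record_event p a b : measurable (record_event p a b).
Proof.
have mtau i : measurable [set x | t i x <= tau].
  have := measurable_fun_ler (measurable_funPT (t i)) (measurable_cst tau).
  by move=> /(_ measurableT [set true] I); rewrite setTI.
have mlt i j : measurable [set x | t i x < t j x].
  have := measurable_fun_ltr (measurable_funPT (t i)) (measurable_funPT (t j)).
  by move=> /(_ measurableT [set true] I); rewrite setTI.
(* The event is a finite Boolean combination of comparisons between arrival times and constants. *)
have -> : record_event p a b = t p @^-1` `]a, b] `&`
    ((\bigcap_(j in [set j : 'I_n | (j < p)%N]) [set x | t p x < t j x]) `&`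
     (\bigcap_(j in [set j : 'I_n | (p < j)%N])
        ([set x | t j x <= tau] `|` [set x | t p x < t j x] `|`
         \bigcup_(i in [set i : 'I_n | (i < j)%N]) [set x | t i x <= tau]))).
  apply/seteqP; split=> x /=.
    move=> [tp [better worse]]; split; first by rewrite in_itv.
    split=> j /= jp; first exact: better.
    have [|tauj] := leP (t j x) tau; first by left; left.
    have [tjp|] := leP (t j x) (t p x); last by left; right.
    by right; have [|i ij ti] := worse j jp; [rewrite tauj|exists i].
  move=> [tp [better worse]]; split; first by move: tp; rewrite in_itv.
  split=> j jp; first exact: better.
  move=> /andP[tauj tjp]; have [[|]|] := worse j jp.
  - by rewrite /= leNgt tauj.
  - by rewrite /= ltNge tjp.
  - by move=> [i ij ti]; exists i.
apply: measurableI; first exact: measurable_arrival.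
apply: measurableI; apply: fin_bigcap_measurable => // j _.
apply: measurableU; last exact: fin_bigcup_measurable.
exact: measurableU.
Qed.

Lemma record_event_add p (a b c : R) : a <= b -> b <= c ->
  pr P (record_event p a b) + pr P (record_event p b c) <=
  pr P (record_event p a c).
Proof.
move=> ab bc; rewrite -prU; try exact: measurable_record_event.
  apply: le_pr; try exact: measurable_record_event.
    by apply: measurableU; exact: measurable_record_event.
  move=> x [] [/andP[tp1 tp2] rec]; split=> //.
    by rewrite tp1 (le_trans tp2).
  by rewrite tp2 (le_lt_trans ab).
apply/seteqP; split=> // x [[/andP[_ tp] _] [/andP[tp' _] _]].
by move: tp; rewrite leNgt tp'.
Qed.

(* Lower bound on the integrand times the length of a short interval: [p]
   arrives in it, the better elements after it, and the best of the others
   before [tau]. *)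
Lemma pr_record_event_step (p : 'I_n) (b c : R) : tau <= b -> b <= c -> c <= 1 ->
  0 < c ->
  (1 - c) ^+ p * (c - b) * (tau / c) <= pr P (record_event p b c).
Proof.
move=> taub bc c1 c0.
have b0 : 0 <= b by exact: le_trans taub.
have c01 : 0 <= c <= 1 by rewrite (ltW c0).
(* The better elements are sent after [c] and [p] into the interval; the worse ones, listed in [s],
   stay free for [shielded]. *)
pose A0 (i : 'I_n) : set R :=
  if [pred i : 'I_n | (i < p)%N] i then `]c, +oo[%classic else setT.
pose A := constrain A0 p `]b, c].
pose s := [seq j : 'I_n <- enum 'I_n | (p < j)%N].
have mA0 i : measurable (A0 i) by rewrite /A0; case: ifP.
have mA i : measurable (A i) by exact: measurable_constrain.
have A0p : A0 p = setT by rewrite /A0 /= ltnn.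
have -> : (1 - c) ^+ p * (c - b) = pr P (rect t A).
  rewrite (pr_constrain t_indep)// (pr_rect_half t_indep t_unif)//.
  by rewrite pr_arrival_oc// card_ord_lt// ltnW.
apply: (le_trans (pr_rect_shielded t_indep t_unif (s := s) mA _ _ c0 c1 _ _)) => //.
- exact: le_trans bc.
- by rewrite filter_uniq// enum_uniq.
- move=> j; rewrite mem_filter => /andP[pj _].
  rewrite /A /constrain /A0 /= (ltnNge j p) (ltnW pj)/=; case: eqP => // jp.
  by move: pj; rewrite jp ltnn.
have s_sorted : sorted (fun i j : 'I_n => (i < j)%N) s.
  apply: sorted_filter; first by move=> i j l; exact: ltn_trans.
  by have := iota_ltn_sorted 0 n; rewrite -val_enum_ord sorted_map.
apply: le_pr.
- apply: measurableI; last exact: measurable_shielded.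
  exact: measurable_rect.
- exact: measurable_record_event.
move=> x [Ax sh].
have : A p (t p x) by exact: Ax.
rewrite /A /constrain eqxx /= in_itv/= => tp; split=> //.
split=> j jp.
  have := Ax j; rewrite /A /constrain /A0 /= jp; case: eqP => [jp'|_].
    by move: jp; rewrite jp' ltnn.
  rewrite /= in_itv/= andbT; apply: le_lt_trans.
  by case/andP: tp.
move=> /andP[tauj tjp]; apply: (shielded_blocked s_sorted sh).
  by rewrite mem_filter jp mem_enum.
by rewrite tauj (le_trans tjp)//; case/andP: tp.
Qed.

Lemma pr_record_event_best (p : 'I_n) (a b : R) : p = 0%N :> nat ->
  tau <= a -> a <= b -> b <= 1 ->
  tau * ln (b / a) <= pr P (record_event p a b).
Proof.
move=> p0 taua ab b1; have [a0|a0] := leP a 0.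
  (* The logarithmic bound needs a positive left end; otherwise [tau] vanishes and the claim is
     trivial. *)
  have -> : tau = 0 by apply/eqP; rewrite eq_le (le_trans taua).
  by rewrite mul0r pr_ge0.
apply: (@ln_le_superadditive _ (fun a b => pr P (record_event p a b))) => //.
  by move=> x y z _ xy yz _; exact: record_event_add.
move=> x y ax xy yb.
have y0 : 0 < y by rewrite (lt_le_trans a0)// (le_trans ax).
have := @pr_record_event_step p x y (le_trans taua ax) xy (le_trans yb b1) y0.
by rewrite p0 expr0 mul1r; apply: le_trans; rewrite mulrAC mulrC.
Qed.

Lemma pr_record_event_second (p : 'I_n) (a b : R) : p = 1%N :> nat ->
  tau <= a -> a <= b -> b <= 1 ->
  tau * ln (b / a) - tau * (b - a) <= pr P (record_event p a b).
Proof.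
move=> p1 taua ab b1; have [a0|a0] := leP a 0.
  have -> : tau = 0 by apply/eqP; rewrite eq_le (le_trans taua).
  by rewrite !mul0r subr0 pr_ge0.
rewrite lerBlDr.
(* The integrand is (1 - x) tau / x = tau / x - tau; adding the additive term tau (b - a) restores
   the form s / x. *)
apply: (@ln_le_superadditive _
  (fun a b => pr P (record_event p a b) + tau * (b - a))) => //.
  move=> x y z _ xy yz _; have := record_event_add p xy yz.
  lra.
move=> x y ax xy yb.
have y0 : 0 < y by rewrite (lt_le_trans a0)// (le_trans ax).
have := @pr_record_event_step p x y (le_trans taua ax) xy (le_trans yb b1) y0.
rewrite p1 expr1 -(lerD2r (tau * (y - x))); apply: le_trans.
by rewrite le_eqVlt; apply/orP; left; apply/eqP; field; rewrite gt_eqF.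
Qed.

(* For [k = n] there is no element of rank [k + 1], and [V] is just the event
   that [p] arrives after [tau]. *)
Lemma pr_top_sampled (k : nat) (p : 'I_n) : p = 0%N :> nat ->
  (k <= n)%N -> tau <= 1 ->
  exists V : set T, [/\ measurable V,
    1 - tau - (1 - tau) ^+ k.+1 <= pr P V &
    forall x, V x -> tau < t p x /\
      ((k < n)%N -> exists2 i : 'I_n, (i <= k)%N & t i x <= tau)].
Proof.
move=> p0 kn tau1; have tau01 : 0 <= tau <= 1 by rewrite tau_ge0.
have mp : measurable (t p @^-1` `]tau, +oo[) by exact: measurable_arrival.
move: kn; rewrite leq_eqVlt => /predU1P[->|kn].
  exists (t p @^-1` `]tau, +oo[); split=> //.
    by rewrite (pr_arrival_gt t_unif)// gerBl exprn_ge0// subr_ge0.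
  by move=> x /=; rewrite in_itv/= andbT ltnn; split.
(* [rect t A] says that the k + 1 best elements all arrive after [tau]; it lies inside the event
   that [p] does, so subtraction gives the bound. *)
pose A (i : 'I_n) : set R :=
  if [pred i : 'I_n | (i < k.+1)%N] i then `]tau, +oo[%classic else setT.
have mA : measurable (rect t A).
  by apply: measurable_rect => i; rewrite /A; case: ifP.
exists (t p @^-1` `]tau, +oo[ `\` rect t A); split.
- exact: measurableD.
- have := prDI P mp mA; rewrite (pr_arrival_gt t_unif)// setIidr; last first.
    by move=> x /(_ p); rewrite /A /= p0.
  by rewrite (pr_rect_half t_indep t_unif)// card_ord_lt// => /eqP;
    rewrite -subr_eq => /eqP ->.
move=> x [/=]; rewrite in_itv/= andbT => taup notA; split=> // _.
apply: contrapT => none; apply: notA => i; rewrite /A /=; case: ifP => //.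
rewrite ltnS /= in_itv/= andbT => ik; rewrite ltNge; apply/negP => ti.
by apply: none; exists i.
Qed.

End Records.

(** * Elementary inequalities used for [alpha3] *)

Lemma bernoulli_ineq (R : realType) (x : R) k :
  0 <= x <= 1 -> 1 - k%:R * x <= (1 - x) ^+ k.
Proof.
move=> /andP[x0 x1]; elim: k => [|k IH]; first by rewrite mul0r subr0 expr0.
rewrite exprS (le_trans _ (ler_wpM2l _ IH)) ?subr_ge0// -natr1.
have : 0 <= k%:R * x * x by rewrite !mulr_ge0.
lra.
Qed.

(* Shows that the best element is accepted with probability at least 1/k times
   the probability of [V] in [pr_top_sampled], without an exchangeability
   argument. *)
Lemma le_tau_ln (R : realType) (k : nat) (tau : R) : 0 <= tau <= 1 ->
  1 - tau - (1 - tau) ^+ k.+1 <= k%:R * (tau * ln (1 / tau)).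
Proof.
move=> tau01; have /andP[tau0 tau1] := tau01.
have [->|tau_neq0] := eqVneq tau 0; first by rewrite !subr0 expr1n !mul0r mulr0 subrr.
have tau_gt0 : 0 < tau by rewrite lt_neqAle eq_sym tau_neq0.
have ln_tau : 1 - tau <= ln (1 / tau).
  have := @le_ln1Dx R (tau - 1); rewrite addrCA subrr addr0 div1r lnV ?posrE//.
  by move=> h; rewrite lerNr opprB h// ltrBrDr addNr.
have b := bernoulli_ineq k tau01.
(* The left side of the goal factors this way; Bernoulli bounds its second factor, and 1 - tau <= ln
   (1 / tau) finishes. *)
have : (1 - tau) * (1 - (1 - tau) ^+ k) <= (1 - tau) * (k%:R * tau).
  by apply: ler_wpM2l; [rewrite subr_ge0|move: b; lra].
have : k%:R * tau * (1 - tau) <= k%:R * tau * ln (1 / tau).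
  by apply: ler_wpM2l => //; rewrite mulr_ge0.
rewrite exprS; lra.
Qed.

(** * Robustness, then consistency by cases on the gap *)

Theorem mainTheorem5 (R : realType) (d : measure_display)
    (T : measurableType d) (P : probability T R)
    (n : nat) (hn : (2 <= n)%N)
    (w : 'I_n -> R) (w_ge0 : forall i, 0 <= w i)
    (w_noninc : forall i j : 'I_n, (i <= j)%N -> w j <= w i)
    (t : 'I_n -> {RV P >-> R})
    (t_indep : mutually_independent t) (t_unif : forall i, uniform01 (t i))
    (k : nat) (hk : (2 <= k <= n)%N)
    (i1 ik : 'I_n) (hi1 : i1 = 0%N :> nat) (hik : ik = k.-1 :> nat)
    (tau gamma : R) (htau : 0 <= tau < 1) (hgamma : 0 <= gamma < 1 - tau) :
  let ALG (chat : R) (x : T) := alg w (fun i => t i x) chat tau gamma in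
  let ck := w i1 - w ik in
  ((Num.min (Num.min (alpha1 tau gamma) (alpha2 tau gamma))
            (Num.max (alpha3 k tau) (alpha4 tau)) * w i1)%:E
     <= 'E_P[ALG ck])%E /\
  (forall chat : R,
    ((tau * ln (1 / (1 - gamma)) * w i1)%:E <= 'E_P[ALG chat])%E).
Proof.
move=> ALG ck; have /andP[tau0 tau1] := htau; have /andP[gamma0 gamma1] := hgamma.
have /andP[k2 kn] := hk.
have gamma_lt1 : 1 - gamma <= 1 by rewrite gerBl.
have tau_lt : tau < 1 - gamma by rewrite ltrBrDr addrC -ltrBrDr.
pose i2 : 'I_n := Ordinal hn.
have i12 : (i1 < i2)%N by rewrite hi1.
have lt_i2 (i : 'I_n) : (i < i2)%N -> i = i1.
  by rewrite ltnS leqn0 => /eqP i0; apply: val_inj; rewrite /= i0 hi1.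
pose late := record_event t tau i1 (1 - gamma) 1.
pose rec1 := record_event t tau i1 tau 1.
pose rec2 := record_event t tau i2 tau 1.
have mlate : measurable late by exact: measurable_record_event.
have mrec1 : measurable rec1 by exact: measurable_record_event.
have mrec2 : measurable rec2 by exact: measurable_record_event.
have pr_late : tau * ln (1 / (1 - gamma)) <= pr P late.
  by apply: pr_record_event_best => //; exact: ltW.
have pr_rec1 : tau * ln (1 / tau) <= pr P rec1.
  by apply: pr_record_event_best => //; exact: ltW.
have pr_rec2 : tau * ln (1 / tau) - tau * (1 - tau) <= pr P rec2.
  by apply: pr_record_event_second => //; exact: ltW.
have w1 : 0 <= w i1 by exact: w_ge0.
(* After 1 - gamma the condition on the prediction is vacuous, so this holds for every [chat]. *)
have lateE chat x : late x -> ALG chat x = w i1.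
  move=> [/andP[tlate _] rec]; apply: (first_record_alg w_ge0 w_noninc) rec => //.
    exact: lt_trans tlate.
  by rewrite leNgt tlate.
have late_rec1 x : late x -> rec1 x.
  move=> [/andP[tlate t1] rec]; split=> //.
  by rewrite t1 (lt_trans _ tlate).
have rec1E chat x : chat <= w i1 -> rec1 x -> ALG chat x = w i1.
  move=> chat1 [/andP[trec _] rec].
  by apply: (first_record_alg w_ge0 w_noninc) rec.
have rec2E chat x : chat <= w i2 -> rec2 x -> ALG chat x = w i2.
  move=> chat2 [/andP[trec _] rec].
  by apply: (first_record_alg w_ge0 w_noninc) rec.
have beats1 x : tau < t i1 x -> beats_sample (fun i => t i x) tau i1.
  move=> tx; apply/forallP => j; apply/implyP => tj; rewrite hi1 lt0n.
  apply/eqP => j0; have j1 : j = i1 by apply: val_inj; rewrite /= j0.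
  by move: tj; rewrite j1 leNgt tx.
have ALG_ge0 chat x : 0 <= ALG chat x by exact: alg_ge0.
split=> [|chat]; last first.
  have ms : {in [:: late], forall A, measurable A} by move=> A; rewrite inE => /eqP ->.
  have := le_expectation_indic P (f := ALG chat) ms w1.
  rewrite big_seq1 => le_E; apply: le_trans (le_E _).
    by rewrite lee_fin mulrC ler_wpM2l.
  move=> x; rewrite big_seq1 indicE; have [|_] := boolP (x \in late).
    by move=> /set_mem/lateE ->; rewrite mulr1.
  by rewrite mulr0.
have wk1 : w ik <= w i1 by apply: w_noninc; rewrite hi1.
have ck1 : ck <= w i1 by rewrite /ck gerBl.
have wk2 : w ik <= w i2 by apply: w_noninc; rewrite hik -ltnS prednK// (leq_trans _ k2).
pose win i : set T := (t i @^-1` `]tau, 1 - gamma])%classic.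
have mwin i : measurable (win i) by exact: measurable_arrival.
have winE i x : win i x -> tau < t i x <= 1 - gamma by rewrite /win/= in_itv.
have pr_win i : pr P (win i) = 1 - gamma - tau.
  by rewrite (pr_arrival_oc t_unif)// ltW.
have [ck2|ck2] := ltP (w i2) ck.
  apply: (@le_trans _ _ (alpha1 tau gamma * w i1)%:E).
    by rewrite lee_fin ler_wpM2r// !ge_min lexx.
  have ms : {in [:: win i1; late], forall A, measurable A}.
    by move=> A; rewrite !inE => /orP[] /eqP ->.
  have := le_expectation_indic P (f := ALG ck) ms w1.
  rewrite big_cons big_seq1 => le_E; apply: le_trans (le_E _).
    by rewrite lee_fin mulrC ler_wpM2l// pr_win /alpha1 lerD2l.
  move=> x; rewrite big_cons big_seq1 !indicE.
  have [winx|_] := boolP (x \in win i1).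
    have [|_] := boolP (x \in late).
      move: winx => /set_mem/winE/andP[_ tx].
      by move=> /set_mem[/andP[]]; rewrite ltNge tx.
    rewrite addr0 mulr1; move/set_mem/winE: winx => tx.
    rewrite /ALG (alg_only_early w_ge0 w_noninc tx)//.
      by case/andP: tx => tx _; exact: beats1.
    move=> j wj; apply/val_inj; rewrite /= hi1; apply/eqP; rewrite -leqn0 leqNgt.
    apply/negP => j0; move: ck2; rewrite ltNge (le_trans wj)//.
    exact: w_noninc.
  have [|_] := boolP (x \in late); last by rewrite addr0 mulr0.
  by move=> /set_mem/lateE ->; rewrite add0r mulr1.
have w1h : 0 <= w i1 / 2 by rewrite divr_ge0.
have [ck_half|ck_half] := leP (w i1 / 2) ck.
  apply: (@le_trans _ _ (alpha2 tau gamma * w i1)%:E).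
    by rewrite lee_fin ler_wpM2r// !ge_min lexx orbT.
  pose E2 := (t i1 @^-1` `]1 - gamma, +oo[ `&` win i2)%classic.
  pose E := (win i1 `|` E2)%classic.
  have mE2 : measurable E2.
    by apply: measurableI => //; exact: measurable_arrival.
  have mE : measurable E by exact: measurableU.
  have prE : pr P E = (1 + gamma) * (1 - tau - gamma).
    rewrite prU//; last first.
      apply/seteqP; split=> // x [/winE/andP[_ tx] [/= + _]].
      by rewrite in_itv/= andbT ltNge tx.
    have i12' : i1 != i2 by apply/eqP => i12'; move: i12; rewrite -i12' ltnn.
    rewrite (pr_arrivalI t_indep)// pr_win (pr_arrival_gt t_unif); first by rewrite pr_win; ring.
    by rewrite gamma_lt1 (le_trans tau0 (ltW tau_lt)).
  (* In a late record, an [i2] arriving in the early window must be dominated by a sampled element;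
     only [i1] is better, and it is late. *)
  have E_late x : E x -> late x -> False.
    move=> Ex [/andP[t1 _] [_ r1]]; case: Ex => [/winE|[_ /winE]].
      by move=> /andP[_]; rewrite leNgt t1.
    move=> /andP[t2 t2']; have [|i /lt_i2 ->] := r1 i2 i12.
      by rewrite t2 (le_trans t2')// ltW.
    by rewrite leNgt (lt_trans tau_lt t1).
  have ALG_E x : E x -> ck <= ALG ck x.
    move=> [/winE/andP[tx t1]|[/= + /winE/andP[tx t2]]].
      apply: (early_alg_ge w_ge0 w_noninc (i := i1)).
      by rewrite early_candidateE// tx t1 ck1 beats1.
    rewrite in_itv/= andbT => t1; apply: (early_alg_ge w_ge0 w_noninc (i := i2)).
    rewrite early_candidateE// tx t2 ck2 /=; apply/forallP => j; apply/implyP => tj.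
    rewrite ltnNge leq_eqVlt; apply/negP => /orP[/eqP/val_inj j2|/lt_i2 j1].
      by move: tj; rewrite j2 leNgt tx.
    by move: tj; rewrite j1 leNgt (lt_trans tau_lt t1).
  (* Each event pays w_1 / 2. On [rec1] the gain w_1 covers two of them, and [E] and [late] are
     disjoint; outside [rec1] only [E] can occur, as [late] lies in [rec1]. *)
  have ms : {in [:: E; late; rec1], forall A, measurable A}.
    by move=> A; rewrite !inE => /or3P[] /eqP ->.
  have := le_expectation_indic P (f := ALG ck) ms w1h.
  rewrite !big_cons big_nil => le_E; apply: le_trans (le_E _).
    rewrite lee_fin addr0 (_ : alpha2 tau gamma * _ = w i1 / 2 *
      ((1 + gamma) * (1 - tau - gamma) +
       (tau * ln (1 / (1 - gamma)) + tau * ln (1 / tau)))).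
      by rewrite prE ler_wpM2l// lerD2l lerD.
    by rewrite /alpha2; field.
  move=> x; rewrite !big_cons big_nil !indicE addr0.
  have [|rec1x] := boolP (x \in rec1).
    move=> /set_mem/(rec1E _ _ ck1) ->.
    have [Ex|_] := boolP (x \in E); have [latex|_] := boolP (x \in late).
    - by have := E_late _ (set_mem Ex) (set_mem latex).
    - by rewrite /=; lra.
    - by rewrite /=; lra.
    - by move: w1; rewrite /=; lra.
  have [|_] := boolP (x \in late).
    by move=> /set_mem/late_rec1/mem_set; rewrite (negbTE rec1x).
  have [|_] := boolP (x \in E); last by rewrite !addr0 mulr0.
  by move=> /set_mem/ALG_E; rewrite !addr0 mulr1; exact: le_trans.
apply: (@le_trans _ _ (Num.max (alpha3 k tau) (alpha4 tau) * w i1)%:E).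
  by rewrite lee_fin ler_wpM2r// !ge_min lexx orbT.
have wk_half : w i1 / 2 <= w ik.
  by move: ck_half; rewrite /ck; lra.
rewrite maxr_pMl// EFin_max.
rewrite ge_max; apply/andP; split.
  have [V [mV prV Vx]] := pr_top_sampled t_indep t_unif tau0 hi1 kn (ltW tau1).
  have ms : {in [:: V; rec1], forall A, measurable A}.
    by move=> A; rewrite !inE => /orP[] /eqP ->.
  have := le_expectation_indic P (f := ALG ck) ms w1h.
  rewrite big_cons big_seq1 => le_E; apply: le_trans (le_E _).
    have k0 : 0 < k%:R :> R by rewrite ltr0n (leq_trans _ k2).
    rewrite lee_fin (_ : alpha3 k tau * _ = w i1 / 2 *
      (1 - tau - (1 - tau) ^+ k.+1 + (1 - tau - (1 - tau) ^+ k.+1) / k%:R)).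
      (* The factor (k + 1) / k in [alpha3] splits as 1 + 1 / k: [V] supplies the 1 and [rec1] the 1
         / k. *)
      rewrite ler_wpM2l// lerD// (le_trans _ pr_rec1)// ler_pdivrMr//.
      by rewrite [leRHS]mulrC le_tau_ln// tau0 ltW.
    by rewrite /alpha3 -natr1; field; rewrite gt_eqF.
  move=> x; rewrite big_cons big_seq1 !indicE.
  have [|_] := boolP (x \in rec1).
    move=> /set_mem/(rec1E _ _ ck1) ->.
    by have [_|_] := boolP (x \in V); move: w1; rewrite /=; lra.
  have [|_] := boolP (x \in V); last by rewrite addr0 mulr0.
  move=> /set_mem/Vx[tx below]; rewrite addr0 mulr1.
  have [j algE /forallP bj] := alg_beats_sample gamma w_ge0 w_noninc tx ck1 (beats1 _ tx).
  rewrite /ALG algE (le_trans wk_half)//; apply: w_noninc; rewrite hik.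
  rewrite -ltnS prednK; last exact: leq_trans k2.
  (* For k = n, [ik] is the last index and any accepted element will do. *)
  move: kn; rewrite leq_eqVlt => /predU1P[->|/below[i ik' ti]]; first exact: ltn_ord.
  exact: leq_trans (implyP (bj i) ti) ik'.
(* [rec1] is listed twice because it is worth w_1, two units of w_1 / 2. It is disjoint from [rec2]:
   there [i2] comes before [i1], whereas in [rec1] that would require [i1] in the sample. *)
have ms : {in [:: rec1; rec1; rec2], forall A, measurable A}.
  by move=> A; rewrite !inE => /or3P[] /eqP ->.
have := le_expectation_indic P (f := ALG ck) ms w1h.
rewrite !big_cons big_nil => le_E; apply: le_trans (le_E _).
  rewrite lee_fin addr0.
  rewrite (_ : alpha4 tau * _ = w i1 / 2 * (tau * ln (1 / tau) +
    (tau * ln (1 / tau) + (tau * ln (1 / tau) - tau * (1 - tau))))).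
    by rewrite ler_wpM2l// !lerD.
  by rewrite /alpha4; field.
move=> x; rewrite !big_cons big_nil !indicE addr0.
have [rec1x|_] := boolP (x \in rec1).
  have [|_] := boolP (x \in rec2).
    move/set_mem: rec1x => [/andP[t1 _] [_ r1]].
    move=> /set_mem[/andP[t2 _] [/(_ i1 i12) t21 _]].
    have [|i /lt_i2 ->] := r1 i2 i12; first by rewrite t2 ltW.
    by rewrite leNgt t1.
  by rewrite (rec1E _ _ ck1 (set_mem rec1x)) /=; lra.
have [|_] := boolP (x \in rec2); last by rewrite !addr0 mulr0.
move=> /set_mem/(rec2E _ _ ck2) ->; rewrite !add0r mulr1.
exact: le_trans wk2.
Qed.
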